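(* Let $X$ be a Hadamard space, $K\subseteq X$ closed and convex, $\theta\ge0$, and let $f:K\times K\to\mathbb{R}$ be a pseudo-monotone and $\theta$-under monotone bifunction such that $f(x,x)=0$ and $f(x,\cdot)$ is lower semicontinuous and convex for all $x\in K$. Suppose $S(f,K)\neq\varnothing$ and $f(\cdot,y)$ is $\Delta$-upper semicontinuous for all $y\in K$. Let $\{\lambda_k\}\subset(\theta,\bar\lambda]$ for some $\bar\lambda>\theta$, let $u,x_0\in X$, and let $\{\alpha_k\}\subset(0,1)$ satisfy $\lim_k\alpha_k=0$ and $\sum_{k=1}^\infty\alpha_k=+\infty$. Let $\{x_k\}_{k\ge0}$ be a sequence in $X$, with points $J^f_{\lambda_k}x_k\in K$, satisfying for all $k\ge0$ $$f(J^f_{\lambda_k}x_k,y)+\lambda_k\langle\overrightarrow{x_kJ^f_{\lambda_k}x_k},\overrightarrow{J^f_{\lambda_k}x_ky}\rangle\ge0\quad\forall y\in K,\qquad x_{k+1}=\alpha_ku\oplus(1-\alpha_k)J^f_{\lambda_k}x_k.$$ Then $\{x_k\}$ converges strongly (i.e. in the metric) to $\mathrm{Proj}_{S(f,K)}u$.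
   Context: A Hadamard space is a complete CAT(0) space. $(1-t)x\oplus ty$ denotes the unique point $z$ of the geodesic segment $[x,y]$ with $d(x,z)=t\,d(x,y)$ and $d(y,z)=(1-t)d(x,y)$. $\mathrm{Proj}_S u$ is the nearest point of a nonempty closed convex set $S$ to $u$. Quasi-linearization: $\langle\overrightarrow{ab},\overrightarrow{cd}\rangle=\frac12\{d^2(a,d)+d^2(b,c)-d^2(a,c)-d^2(b,d)\}$ for $a,b,c,d\in X$. For a bounded sequence $\{x_k\}$ the asymptotic center is the set of minimizers over $x\in X$ of $\limsup_k d(x,x_k)$. $\{x_k\}$ $\Delta$-converges to $x$ if every subsequence of $\{x_k\}$ has asymptotic center $\{x\}$. Convexity of a function is along geodesics. $f$ is pseudo-monotone if $f(x,y)\ge0$ with $x,y\in K$ implies $f(y,x)\le0$; $\theta$-under monotone if $f(x,y)+f(y,x)\le\theta d^2(x,y)$ for all $x,y\in K$. $f(\cdot,y)$ is $\Delta$-upper semicontinuous if $\limsup_n f(x_n,y)\le f(x,y)$ whenever $\{x_n\}\subset K$ $\Delta$-converges to $x\in K$. $S(f,K)=\{x\in K: f(x,y)\ge0\ \forall y\in K\}$ is the set of equilibrium points. $J^f_\lambda x$ (the resolvent, $\lambda>\theta$, $x\in X$) denotes the point $z\in K$ with $f(z,y)+\lambda\langle\overrightarrow{xz},\overrightarrow{zy}\rangle\ge0$ for all $y\in K$ (such a $z$ is unique when it exists). *)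

(* Defs.v *)
From HB Require Import structures.
From mathcomp Require Import all_boot all_order all_algebra.
From mathcomp Require Import all_classical all_reals all_analysis.

Set Implicit Arguments.
Unset Strict Implicit.
Unset Printing Implicit Defensive.

Import Order.TTheory GRing.Theory Num.Theory.
Import numFieldNormedType.Exports.

Local Open Scope classical_set_scope.
Local Open Scope ring_scope.

Section Hadamard.
Context {R : realType}.

(* R * R carries the sup norm in the library, hence an explicit Euclidean
   distance for comparison triangles. *)
Definition eucl_dist (a b : R * R) : R :=
  Num.sqrt ((a.1 - b.1) ^+ 2 + (a.2 - b.2) ^+ 2).

Definition eucl_comb (t : R) (a b : R * R) : R * R :=
  ((1 - t) * a.1 + t * b.1, (1 - t) * a.2 + t * b.2).

Context {X : metricType R}.
Implicit Types (x y z p q : X) (K S : set X) (f : X -> X -> R) (t : R).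

(* Only the values of c on [0, d(x, y)] matter. *)
Definition is_geodesic x y (c : R -> X) : Prop :=
  [/\ c 0 = x, c (mdist x y) = y &
      forall s t, 0 <= s <= mdist x y -> 0 <= t <= mdist x y ->
        mdist (c s) (c t) = `|s - t|].

(* Without unique geodesics this is the union of all geodesic segments
   from x to y; in a CAT(0) space it is the segment [x, y]. *)
Definition geod_segment x y : set X :=
  [set z | exists2 c, is_geodesic x y c &
           exists2 s, 0 <= s <= mdist x y & z = c s].

(* z = (1 - t) x (+) t y *)
Definition is_geod_comb t x y z : Prop :=
  [/\ geod_segment x y z, mdist x z = t * mdist x y &
      mdist y z = (1 - t) * mdist x y].

(* Every geodesic triangle is at least as thin as its comparison triangle in
   the Euclidean plane.  It is enough to compare points of two sides issuing
   from the same vertex x, since the labelling of the vertices is arbitrary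
   and points of one and the same side are compared trivially. *)
Definition thin_triangles : Prop :=
  forall (x y z : X) (x' y' z' : R * R),
    eucl_dist x' y' = mdist x y -> eucl_dist y' z' = mdist y z ->
    eucl_dist x' z' = mdist x z ->
  forall s t p q, is_geod_comb s x y p -> is_geod_comb t x z q ->
    mdist p q <= eucl_dist (eucl_comb s x' y') (eucl_comb t x' z').

Definition is_cat0 : Prop :=
  (forall x y, exists c, is_geodesic x y c) /\ thin_triangles.

(* completeType is not usable here: it requires a pointed type. *)
Definition is_complete : Prop :=
  forall x : nat -> X, cauchy (x @ \oo) -> exists l : X, x @ \oo --> l.

Definition is_hadamard : Prop := is_complete /\ is_cat0.

Definition geod_convex K : Prop :=
  forall x y, K x -> K y -> geod_segment x y `<=` K.

Definition geod_convex_fun K (g : X -> R) : Prop :=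
  forall x y z t, K x -> K y -> 0 <= t <= 1 -> is_geod_comb t x y z ->
    g z <= (1 - t) * g x + t * g y.

(* Lower semicontinuity on K for the topology induced on K; points outside K
   are isolated in subspace K, so nothing is required of g there. *)
Definition lower_semicontinuous_on K (g : X -> R) : Prop :=
  lower_semicontinuous (fun y : subspace K => (g y)%:E).

Definition is_proj S x p : Prop :=
  unique (fun q => S q /\ forall r, S r -> mdist x q <= mdist x r) p.

Definition quasi_lin (a b c d : X) : R :=
  (mdist a d ^+ 2 + mdist b c ^+ 2 - mdist a c ^+ 2 - mdist b d ^+ 2) / 2.

Definition bounded_sequence (x : nat -> X) : Prop :=
  exists (a : X) (M : R), forall k, mdist a (x k) <= M.

Definition asymptotic_center (x : nat -> X) : set X :=
  [set p | forall q, (limn_esup (fun k => (mdist p (x k))%:E) <=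
                      limn_esup (fun k => (mdist q (x k))%:E))%E].

Definition Delta_cvg (x : nat -> X) p : Prop :=
  bounded_sequence x /\
  forall phi : nat -> nat, increasing_seq phi ->
    asymptotic_center (x \o phi) = [set p].

Definition Delta_upper_semicontinuous_on K (g : X -> R) : Prop :=
  forall (x : nat -> X) p, (forall n, K (x n)) -> K p -> Delta_cvg x p ->
    (limn_esup (fun n => (g (x n))%:E) <= (g p)%:E)%E.

(* A bifunction on K * K is represented by a total f whose values outside
   K * K are irrelevant. *)
Definition pseudo_monotone K f : Prop :=
  forall x y, K x -> K y -> 0 <= f x y -> f y x <= 0.

Definition under_monotone K (theta : R) f : Prop :=
  forall x y, K x -> K y -> f x y + f y x <= theta * mdist x y ^+ 2.

Definition equilibrium_points K f : set X :=
  [set x | K x /\ forall y, K y -> 0 <= f x y].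

(* z = J^f_lambda x *)
Definition is_resolvent K f (lambda : R) x z : Prop :=
  K z /\ forall y, K y -> 0 <= f z y + lambda * quasi_lin x z z y.

End Hadamard.

Arguments is_hadamard {R} X.

(* Main.v *)
(* For p in S = S(f, K), pseudo-monotonicity turns the resolvent inequality into
   d(J x_k, p)^2 <= d(x_k, p)^2 - d(x_k, J x_k)^2.  Combined with the CN
   inequality this gives, for p = Proj_S u, s_k = d(x_k, p)^2 and
   g_k = d(x_k, J x_k)^2,
     s_(k+1) <= (1 - a_k) s_k - (1 - a_k) g_k + a_k t_k,
     t_k = d(u, p)^2 - (1 - a_k) d(u, J x_k)^2.
   For every e > 0 there is d > 0 such that eventually t_k <= e as soon as
   d(x_k, J x_k) < d: otherwise Delta-compactness yields a point of S which is
   closer to u than p.  When d(x_k, J x_k) >= d, the term in g_k absorbs the one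
   in t_k because a_k -> 0.  Hence eventually
   s_(k+1) <= (1 - a_k) s_k + a_k e, and the divergence of the series of the a_k
   forces s_k -> 0. *)

Require Import Defs.
From HB Require Import structures.
From mathcomp Require Import all_boot all_order all_algebra.
From mathcomp Require Import all_classical all_reals all_analysis.
From mathcomp Require Import ring lra.

Set Implicit Arguments.
Unset Strict Implicit.
Unset Printing Implicit Defensive.

Import Order.TTheory GRing.Theory Num.Theory.
Import numFieldNormedType.Exports.

Local Open Scope classical_set_scope.
Local Open Scope ring_scope.

(** * CAT(0) geometry: geodesic points, the CN inequality, balls *)

Section Geometry.
Context {R : realType} {X : metricType R}.
Implicit Types (w x y z a b m : X) (S C : set X) (t : R).

Lemma geod_comb_exists x y t : @is_cat0 R X -> 0 <= t <= 1 ->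
  exists z, is_geod_comb t x y z.
Proof.
move=> [geo _] /andP[t0 t1]; have [c cg] := geo x y; exists (c (t * mdist x y)).
have d0 := mdist_ge0 x y.
have td : 0 <= t * mdist x y <= mdist x y by rewrite mulr_ge0//= ler_piMl.
have [c0 c1 cd] := cg; split.
- by exists c => //; exists (t * mdist x y).
- by rewrite -{1}c0 cd ?lexx// sub0r normrN ger0_norm// mulr_ge0.
- rewrite -{1}c1 cd ?lexx ?d0//; rewrite ger0_norm; last by lra.
  by ring.
Qed.

Lemma geod_segment_comb x y z : geod_segment x y z ->
  exists2 t, 0 <= t <= 1 & is_geod_comb t x y z.
Proof.
move=> sz; have [c cg [s sd zE]] := sz; have [c0 c1 cd] := cg.
have d0 := mdist_ge0 x y.
have xz : mdist x z = s.
  rewrite zE -{1}c0 cd ?lexx// sub0r normrN ger0_norm//; first by case/andP: sd.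
have yz : mdist y z = mdist x y - s.
  by rewrite zE -{1}c1 cd ?lexx ?d0// ger0_norm// subr_ge0; case/andP: sd.
(* For [x = y] the ratio [s / mdist x y] carries no information; [t = 0] works, since all distances
   vanish. *)
have [d_eq0|d_neq0] := eqVneq (mdist x y) 0.
  exists 0; first by rewrite lexx ler01.
  have s0 : s = 0 by move: sd; rewrite d_eq0 -eq_le => /eqP.
  by split => //; rewrite ?xz ?yz d_eq0 s0 ?mulr0 ?subr0.
have dgt0 : 0 < mdist x y by rewrite lt_neqAle eq_sym d_neq0.
exists (s / mdist x y).
  by case/andP: sd => s0 sd; rewrite divr_ge0//= ler_pdivrMr// mul1r.
by split => //; rewrite ?xz ?yz; field.
Qed.

(* The Bruhat-Tits (CN) inequality, from the comparison triangle with vertices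
   (0, 0), (d(a, b), 0) and (h, k). *)
Lemma cn_ineq a b m w t : @is_cat0 R X -> 0 <= t <= 1 ->
  is_geod_comb t a b m ->
  mdist m w ^+ 2 <= (1 - t) * mdist a w ^+ 2 + t * mdist b w ^+ 2
                    - t * (1 - t) * mdist a b ^+ 2.
Proof.
move=> [geo thin] t01 mt; have [_ am bm] := mt.
have [|ab_neq0] := eqVneq (mdist a b) 0.
  move=> ab0; have ab := mdist_positivity _ _ ab0.
  have ma : a = m by apply: mdist_positivity; rewrite am ab0 mulr0.
  by rewrite -ma -ab mdistxx; lra.
have D0 : 0 < mdist a b by rewrite lt_neqAle eq_sym ab_neq0 mdist_ge0.
have aw0 := mdist_ge0 a w; have bw0 := mdist_ge0 b w.
have T1 := metric_triangle a b w.
have T2 := metric_triangle a w b; rewrite (metric_sym w b) in T2.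
have T3 := metric_triangle b a w; rewrite (metric_sym b a) in T3.
move: D0 aw0 bw0 T1 T2 T3 => D0 p0 q0 T1 T2 T3.
set D := mdist a b in D0 T1 T2 T3 *; set p := mdist a w in p0 T1 T2 T3 *.
set q := mdist b w in q0 T1 T2 T3 *.
(* By the law of cosines, [h] is the abscissa of the comparison point of [w]; the triangle
   inequalities give [h ^+ 2 <= p ^+ 2], so that the height [k] is real. *)
pose h := (D ^+ 2 + p ^+ 2 - q ^+ 2) / (2 * D).
have hD : 2 * D * h = D ^+ 2 + p ^+ 2 - q ^+ 2 by rewrite /h; field; lra.
have h2 : h ^+ 2 <= p ^+ 2.
  have e1 : h <= p by rewrite /h ler_pdivrMr; [nra|lra].
  have e2 : - p <= h by rewrite /h ler_pdivlMr; [nra|lra].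
  nra.
pose k := Num.sqrt (p ^+ 2 - h ^+ 2).
have k2 : k ^+ 2 = p ^+ 2 - h ^+ 2 by rewrite sqr_sqrtr// subr_ge0.
have E1 : eucl_dist (0, 0) (D, 0 : R) = D.
  rewrite /eucl_dist/= (_ : _ + _ = D ^+ 2); last by ring.
  by rewrite sqrtr_sqr ger0_norm// ltW.
have E2 : eucl_dist (D, 0 : R) (h, k) = q.
  rewrite /eucl_dist/= (_ : _ + _ = q ^+ 2); last by rewrite sub0r sqrrN k2; nra.
  by rewrite sqrtr_sqr ger0_norm.
have E3 : eucl_dist (0, 0) (h, k) = p.
  rewrite /eucl_dist/= (_ : _ + _ = p ^+ 2).
    by rewrite sqrtr_sqr ger0_norm.
  by rewrite !sub0r !sqrrN k2; ring.
(* Thinness compares points of two sides from [a]; the point on the side to [w] is taken to be [w]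
   itself, with ratio 1. *)
have ww : is_geod_comb 1 a w w.
  have [c cg] := geo a w; split; last 2 first.
  - by rewrite mul1r.
  - by rewrite subrr mul0r mdistxx.
  - exists c => //; exists (mdist a w); first by rewrite lexx mdist_ge0.
    by have [_ -> _] := cg.
have := thin _ _ _ _ _ _ E1 E2 E3 _ _ _ _ mt ww.
rewrite /eucl_dist /eucl_comb /= => mw.
rewrite -(ler_sqr (x := mdist m w)) ?nnegrE ?mdist_ge0 ?sqrtr_ge0// in mw.
rewrite sqr_sqrtr ?addr_ge0 ?sqr_ge0// in mw.
(* Here (tD - h)^2 + k^2 = t^2 D^2 - 2tDh + p^2, and [hD] eliminates h. *)
by apply: (le_trans mw); nra.
Qed.

Lemma convexI S C : geod_convex S -> geod_convex C -> geod_convex (S `&` C).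
Proof.
by move=> Sc Cc x y [? ?] [? ?] z xyz; split; [apply: Sc xyz|apply: Cc xyz].
Qed.

(** The CN inequality bounds squared distances, hence balls with squared radius; a negative [r]
    gives the empty set. *)
Lemma convex_sqball w (r : R) : @is_cat0 R X ->
  geod_convex [set z | mdist w z ^+ 2 <= r].
Proof.
move=> X0 x y /= xr yr z /geod_segment_comb[t t01 zt].
have := cn_ineq w X0 t01 zt; rewrite !(metric_sym _ w); case/andP: t01 => t0 t1.
have : 0 <= t * (1 - t) * mdist x y ^+ 2.
  by apply: mulr_ge0; rewrite ?sqr_ge0//; apply: mulr_ge0; rewrite ?subr_ge0.
have : (1 - t) * mdist w x ^+ 2 <= (1 - t) * r by rewrite ler_wpM2l// subr_ge0.
have : t * mdist w y ^+ 2 <= t * r by rewrite ler_wpM2l.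
by rewrite /=; lra.
Qed.

Lemma closed_metricP S :
  (forall x, (forall e, 0 < e -> exists2 y, S y & mdist x y < e) -> S x) <->
  closed S.
Proof.
split=> [H x xS|cS x xS].
  apply: H => e e0; have [|y [Sy xy]] := xS (ball x e); first exact: nbhsx_ballx.
  by exists y => //; move: xy; rewrite ballEmdist.
apply: cS => B /nbhs_ballP[e /= e0 eB]; have [y Sy xy] := xS _ e0.
by exists y; split => //; apply: eB; rewrite ballEmdist.
Qed.

Lemma closed_sqball w (r : R) : closed [set z : X | mdist w z ^+ 2 <= r].
Proof.
apply/closed_metricP => x xS /=; apply/ler_addgt0Pr => e e0.
have d0 := mdist_ge0 w x; have dd : 0 < 2 * mdist w x + 1 by lra.
(* If d(x, y) < c <= 1, then d(w, x)^2 - d(w, y)^2 <= c (2 d(w, x) + 1), by factoring the difference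
   of squares. *)
have [|y yr xy] := xS (Num.min 1 (e / (2 * mdist w x + 1))).
  by rewrite lt_min ltr01 divr_gt0.
move: xy; rewrite lt_min ltr_pdivlMr// => /andP[xy1 xy2].
have := metric_triangle w y x; rewrite (metric_sym y x) => T.
have T2 := metric_triangle w x y; have := mdist_ge0 x y; have := mdist_ge0 w y.
rewrite /= in yr; nra.
Qed.

End Geometry.

(** * Limsup bounds as eventual real inequalities *)

Section Limsup.
Context {R : realType}.

Lemma limn_esup_leP (v : nat -> R) (a : R) :
  (limn_esup (fun k => (v k)%:E) <= a%:E)%E <->
  (forall e, 0 < e -> \forall k \near \oo, v k <= a + e).
Proof.
split=> [va e e0|va].
  have : (limn_esup (fun k => (v k)%:E) < (a + e)%:E)%E.
    by apply: (le_lt_trans va); rewrite lte_fin ltrDl.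
  move=> /ereal_inf_lt[_ [V Voo <-] Ve]; apply: filterS Voo => k Vk.
  rewrite -lee_fin; apply: le_trans (ltW Ve).
  by apply: ereal_sup_ubound; exists k.
apply/lee_addgt0Pr => e e0; rewrite /limn_esup limf_esupE.
have Ve := va _ e0.
apply: (@le_trans _ _ (ereal_sup [set (v k)%:E | k in [set k | v k <= a + e]])).
  by apply: ereal_inf_lbound; exists [set k | v k <= a + e].
by apply: ge_ereal_sup => _ [k /= vk <-]; rewrite -EFinD lee_fin.
Qed.

Lemma limn_esup_geP (v : nat -> R) (a : R) :
  (forall b, (\forall k \near \oo, v k <= b) -> a <= b) ->
  (a%:E <= limn_esup (fun k => (v k)%:E))%E.
Proof.
move=> H; rewrite leNgt; apply/negP => /ereal_inf_lt[_ [V Voo <-]] Va.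
have [k Vk] := filter_ex Voo.
have ub j : V j -> ((v j)%:E <= ereal_sup [set (v k)%:E | k in V])%E.
  by move=> Vj; apply: ereal_sup_ubound; exists j.
(* The supremum is real: [Va] excludes +oo and the value at [k] excludes -oo. *)
move: Va ub; case: (ereal_sup _) => [b|//|_ /(_ _ Vk)//].
rewrite lte_fin ltNge => /negP + ub; apply; apply: H.
by apply: filterS Voo => j /ub.
Qed.

End Limsup.

(** * Asymptotic centers and metric projections *)

Section Centers.
Context {R : realType} {X : metricType R}.
Implicit Types (y : nat -> X) (c p q w : X) (S C : set X) (a e : R).

(** This is the infimum over [S] of limsup d(q, y_k), phrased with eventual bounds to stay in the
    reals. The infimum is genuine when [y] is bounded and [S] nonempty ([has_inf_radius]). *)
Definition asymp_radius S y : R :=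
  inf [set a | exists2 q, S q & \forall k \near \oo, mdist q (y k) <= a].

(* Constrained asymptotic center; for a constant sequence it is the metric
   projection onto S. *)
Definition is_center S y c : Prop :=
  S c /\ forall e, 0 < e -> \forall k \near \oo, mdist c (y k) <= asymp_radius S y + e.

Lemma near_mdist_ge0 y q a : (\forall k \near \oo, mdist q (y k) <= a) -> 0 <= a.
Proof. by move=> /filter_ex[k]; apply: le_trans; exact: mdist_ge0. Qed.

Lemma radius_le S y q a : S q ->
  (\forall k \near \oo, mdist q (y k) <= a) -> asymp_radius S y <= a.
Proof.
move=> Sq qa; apply: ge_inf; last by exists q.
by exists 0 => b [r _ /near_mdist_ge0].
Qed.

Lemma bounded_sequence_near y q : bounded_sequence y ->
  exists a, \forall k \near \oo, mdist q (y k) <= a.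
Proof.
move=> [a [M yM]]; exists (mdist q a + M); apply: nearW => k.
by apply: le_trans (metric_triangle _ a _) _; rewrite lerD2l.
Qed.

Lemma has_inf_radius S y : bounded_sequence y -> S !=set0 ->
  has_inf [set a | exists2 q, S q & \forall k \near \oo, mdist q (y k) <= a].
Proof.
move=> yb [q Sq]; split; last by exists 0 => b [r _ /near_mdist_ge0].
by have [a qa] := bounded_sequence_near q yb; exists a, q.
Qed.

Lemma radius_ge0 S y : bounded_sequence y -> S !=set0 -> 0 <= asymp_radius S y.
Proof.
move=> yb S0; have [A0 _] := has_inf_radius yb S0.
by apply: lb_le_inf => // b [r _ /near_mdist_ge0].
Qed.

Lemma radius_adherent S y e : bounded_sequence y -> S !=set0 -> 0 < e ->
  exists2 q, S q & \forall k \near \oo, mdist q (y k) <= asymp_radius S y + e.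
Proof.
move=> yb S0 e0; have [a [q Sq qa] ae] := inf_adherent e0 (has_inf_radius yb S0).
exists q => //; apply: filterS qa => k /le_trans; apply; exact: ltW.
Qed.

(** The midpoint of [q] and [q'] lies in [S], so its limsup distance is at least the radius, while
    CN bounds the square of that distance by (r + e)^2 - d(q, q')^2 / 4. Uniqueness and existence of
    centers both rest on this estimate. *)
Lemma near_center_dist S y q q' e : @is_cat0 R X -> geod_convex S ->
  bounded_sequence y -> S q -> S q' ->
  (\forall k \near \oo, mdist q (y k) <= asymp_radius S y + e) ->
  (\forall k \near \oo, mdist q' (y k) <= asymp_radius S y + e) ->
  mdist q q' ^+ 2 <= 4 * ((asymp_radius S y + e) ^+ 2 - asymp_radius S y ^+ 2).
Proof.
move=> X0 Sc yb Sq Sq' qr qr'.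
have h01 : 0 <= (1 / 2 : R) <= 1 by apply/andP; split; lra.
have [m mq] := geod_comb_exists q q' X0 h01.
have Sm : S m by have [sm _ _] := mq; apply: Sc sm.
have r0 : 0 <= asymp_radius S y by apply: radius_ge0 => //; exists q.
set r := asymp_radius S y in r0 qr qr' *.
pose B := (r + e) ^+ 2 - mdist q q' ^+ 2 / 4.
have mB : \forall k \near \oo, mdist m (y k) ^+ 2 <= B.
  near=> k; have qk : mdist q (y k) <= r + e by near: k.
  have qk' : mdist q' (y k) <= r + e by near: k.
  apply: le_trans (cn_ineq (y k) X0 h01 mq) _.
  have := mdist_ge0 q (y k); have := mdist_ge0 q' (y k).
  by rewrite /B; nra.
have B0 : 0 <= B by have [k] := filter_ex mB; apply: le_trans; exact: sqr_ge0.
have rB : r <= Num.sqrt B.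
  apply: radius_le Sm _; apply: filterS mB => k mk.
  by rewrite -(ler_sqr (x := mdist m _)) ?nnegrE ?mdist_ge0 ?sqrtr_ge0// sqr_sqrtr.
by move: rB; rewrite -(ler_sqr (x := r)) ?nnegrE ?sqrtr_ge0// sqr_sqrtr// /B; lra.
Unshelve. all: by end_near. Qed.

Lemma center_unique S y c c' : @is_cat0 R X -> geod_convex S ->
  bounded_sequence y -> is_center S y c -> is_center S y c' -> c = c'.
Proof.
move=> X0 Sc yb [Sx cr] [Sx' cr']; apply: mdist_positivity; apply/eqP.
rewrite eq_le mdist_ge0 andbT leNgt; apply/negP => d0.
have r0 : 0 <= asymp_radius S y by apply: radius_ge0 => //; exists c.
set r := asymp_radius S y in r0 cr cr'; pose D := mdist c c' ^+ 2.
have D0 : 0 < D by rewrite exprn_gt0.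
(* For 0 < e <= 1, 4 ((r + e)^2 - r^2) = 8re + 4e^2 < e (8r + 5) <= D. *)
pose e := Num.min 1 (D / (8 * r + 5)).
have r5 : 0 < 8 * r + 5 by lra.
have e0 : 0 < e by rewrite lt_min ltr01 divr_gt0.
have := near_center_dist X0 Sc yb Sx Sx' (cr _ e0) (cr' _ e0).
rewrite -/r -/D.
have : e <= 1 by rewrite ge_min lexx.
have : e * (8 * r + 5) <= D by rewrite -ler_pdivlMr// ge_min lexx orbT.
by nra.
Qed.

(** A minimizing sequence for the radius is Cauchy by [near_center_dist]; its limit is a center. *)
Lemma center_exists S y : is_hadamard X -> closed S -> geod_convex S ->
  S !=set0 -> bounded_sequence y -> exists c, is_center S y c.
Proof.
move=> [Xc X0] Scl Sc S0 yb; have r0 := radius_ge0 yb S0.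
have /choice[q qP] n : exists q, S q /\
    \forall k \near \oo, mdist q (y k) <= asymp_radius S y + n.+1%:R^-1.
  have n0 : 0 < n.+1%:R^-1 :> R by rewrite invr_gt0.
  by have [q Sq qr] := radius_adherent yb S0 n0; exists q.
set r := asymp_radius S y in r0 qP.
have qC : cauchy (q @ \oo).
  apply: cauchy_exP => e e0.
  pose d := Num.min 1 (e ^+ 2 / (8 * r + 5)).
  have r5 : 0 < 8 * r + 5 by lra.
  have d0 : 0 < d by rewrite lt_min ltr01 divr_gt0// exprn_gt0.
  have d1 : d <= 1 by rewrite ge_min lexx.
  have dr : d * (8 * r + 5) <= e ^+ 2 by rewrite -ler_pdivlMr// ge_min lexx orbT.
  have [N _ NP] := near_infty_natSinv_lt (PosNum d0).
  have qd n : (N <= n)%N -> \forall k \near \oo, mdist (q n) (y k) <= r + d.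
    move=> /NP/= nd; apply: filterS (qP n).2 => k /le_trans; apply.
    by rewrite lerD2l ltW.
  exists (q N); exists N => // n /= Nn; rewrite ballEmdist/=.
  rewrite -(ltr_sqr (x := mdist _ _)) ?nnegrE ?mdist_ge0 ?(ltW e0)//.
  apply: le_lt_trans (near_center_dist X0 Sc yb (qP N).1 (qP n).1
    (qd _ (leqnn N)) (qd _ Nn)) _; rewrite -/r.
  by nra.
have [c qc] := Xc _ qC.
have near_c e : 0 < e -> exists n, mdist c (q n) < e /\ n.+1%:R^-1 < e.
  move=> e0; near \oo => n; exists n; split; near: n.
    exact: metricType_numDomainType.cvgr_dist_lt qc _ e0.
  exact: near_infty_natSinv_lt (PosNum e0).
exists c; split.
  apply: ((closed_metricP S).2 Scl) => e e0; have [n [cn _]] := near_c _ e0.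
  by exists (q n) => //; exact: (qP n).1.
move=> e e0; have [|n [cn ne]] := near_c (e / 2); first by rewrite divr_gt0.
move: ne (qP n).2; set i := _^-1 => ie; apply: filterS => k qk.
by have := metric_triangle c (q n) (y k); lra.
Unshelve. all: by end_near. Qed.

Lemma proj_exists S w : is_hadamard X -> closed S -> geod_convex S ->
  S !=set0 -> exists p, is_proj S w p.
Proof.
move=> XH Scl Sc S0.
have wb : bounded_sequence (fun=> w) by exists w, 0 => k; rewrite mdistxx.
have nearest p : (S p /\ forall q, S q -> mdist w p <= mdist w q) <->
    is_center S (fun=> w) p.
  split=> -[Sp pP]; split => //.
    move=> e e0; apply: nearW => _; rewrite metric_sym.
    have [q Sq /filter_ex[_ qe]] := radius_adherent wb S0 e0.
    by apply: le_trans (pP _ Sq) _; rewrite metric_sym.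
  move=> q Sq; apply/ler_addgt0Pr => e e0; have [_] := filter_ex (pP _ e0).
  rewrite metric_sym => /le_trans; apply; rewrite lerD2r.
  by apply: (radius_le Sq); apply: nearW => _; rewrite metric_sym.
have [p pP] := center_exists XH Scl Sc S0 wb; exists p; split.
  exact/nearest.
by move=> q /nearest; apply: (center_unique XH.2 Sc wb).
Qed.

(** Otherwise a small move from [p] towards [q] stays in [S] and, by CN, gets closer to [w]. *)
Lemma proj_dist_le S w p q : @is_cat0 R X -> geod_convex S -> is_proj S w p ->
  S q -> mdist p q <= mdist w q.
Proof.
move=> X0 Sc [[Sp pP] _] Sq.
rewrite -ler_sqr ?nnegrE ?mdist_ge0// leNgt; apply/negP => PQ.
set P := mdist p q ^+ 2 in PQ; set Q := mdist w q ^+ 2 in PQ.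
have Q0 : 0 <= Q by exact: sqr_ge0.
have P0 : 0 < P by exact: le_lt_trans Q0 PQ.
(* With this ratio (1 - t) P - Q = (P - Q) / 2 > 0, whereas CN and minimality of [p] give d(p, w)^2
   + (1 - t) P - Q <= 0. *)
pose t := (P - Q) / (2 * P).
have t0 : 0 < t by rewrite divr_gt0//; lra.
have tP : t * (2 * P) = P - Q by rewrite divfK// mulf_neq0 ?pnatr_eq0 ?lt0r_neq0.
have t1 : t <= 1 by rewrite ler_pdivrMr; lra.
have t01 : 0 <= t <= 1 by rewrite ltW.
have [z zt] := geod_comb_exists p q X0 t01.
have Sz : S z by have [sz _ _] := zt; apply: Sc sz.
have := cn_ineq w X0 t01 zt.
have : mdist p w ^+ 2 <= mdist z w ^+ 2.
  by rewrite ler_sqr ?nnegrE ?mdist_ge0// !(metric_sym _ w) pP.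
rewrite (metric_sym q w) -/Q -/P => h1 h2.
have W0 := sqr_ge0 (mdist p w).
have : t * (mdist p w ^+ 2 + (1 - t) * P - Q) <= 0 by lra.
by rewrite pmulr_rle0//; nra.
Qed.

(** The projection of [c] onto [S] is at least as close to every [y k] as [c] is, so it is a center
    too and uniqueness applies. *)
Lemma center_in S y c : is_hadamard X -> closed S -> geod_convex S ->
  (forall k, S (y k)) -> bounded_sequence y -> is_center setT y c -> S c.
Proof.
move=> XH Scl Sc Sy yb cP.
have [p pP] := proj_exists c XH Scl Sc (ex_intro _ _ (Sy 0%N)).
suff -> : c = p by have [[]] := pP.
have Tc : geod_convex [set: X] by [].
apply: (center_unique XH.2 Tc yb cP); split => // e /cP.2; apply: filterS => k.
by apply: le_trans; apply: proj_dist_le XH.2 Sc pP (Sy k).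
Qed.

(** Passes from [is_center], suited to real estimates, to the extended-real limsup used in
    Delta-convergence. *)
Lemma asymptotic_center_eq y c : @is_cat0 R X -> bounded_sequence y ->
  is_center setT y c -> asymptotic_center y = [set c].
Proof.
move=> X0 yb cP; have Tc : geod_convex [set: X] by [].
have cr : (limn_esup (fun k => (mdist c (y k))%:E) <= (asymp_radius setT y)%:E)%E.
  exact/limn_esup_leP/cP.2.
apply/seteqP; split=> p /=; last first.
  by move=> -> q; apply: (le_trans cr); apply: limn_esup_geP => b; exact: radius_le.
move=> /(_ c)/le_trans/(_ cr)/limn_esup_leP pr.
exact: center_unique X0 Tc yb (conj I pr) cP.
Qed.

End Centers.

(** * Subsequences and diagonal extraction *)

Section Subsequences.
Implicit Types (phi psi : nat -> nat).

Lemma increasing_seq_ge phi k : increasing_seq phi -> (k <= phi k)%N.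
Proof.
move=> /increasing_seqP phiP; elim: k => // k IH.
exact: leq_ltn_trans IH (phiP k).
Qed.

Lemma near_subseq (P : set nat) phi : increasing_seq phi ->
  (\forall k \near \oo, P k) -> \forall k \near \oo, P (phi k).
Proof.
move=> phiP [N _ NP]; exists N => // k /= Nk; apply: NP => /=.
exact: leq_trans Nk (increasing_seq_ge _ phiP).
Qed.

Lemma increasing_seq_comp phi psi : increasing_seq phi -> increasing_seq psi ->
  increasing_seq (phi \o psi).
Proof. by move=> phiP psiP m n /=; rewrite phiP; exact: psiP. Qed.

(* Diagonal extraction of a subsequence on which r, which can only decrease
   under passage to subsequences, has become constant. *)
Lemma diagonal_subseq (R : realType) (r : (nat -> nat) -> R) :
  (forall phi, 0 <= r phi) ->
  (forall phi psi, increasing_seq phi -> increasing_seq psi ->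
    r (phi \o psi) <= r phi) ->
  (forall phi n, increasing_seq phi -> r phi <= r (phi \o addn n)) ->
  exists2 phi, increasing_seq phi &
    forall psi, increasing_seq psi -> r phi <= r (phi \o psi).
Proof.
move=> r0 r_sub r_tail.
pose J phi := [set r (phi \o psi) | psi in [set psi : nat -> nat | increasing_seq psi]].
have Jlb phi : has_lbound (J phi) by exists 0 => _ [psi _ <-].
have Jinf phi : has_inf (J phi) by split => //; exists (r (phi \o id)), id.
have /choice[s sP] (np : nat * (nat -> nat)) : exists psi, increasing_seq psi /\
    r (np.2 \o psi) <= inf (J np.2) + np.1.+1%:R^-1.
  have n0 : 0 < np.1.+1%:R^-1 :> R by rewrite invr_gt0.
  have [_ [psi psiP <-] /ltW rpsi] := inf_adherent n0 (Jinf np.2).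
  by exists psi.
(* Stage [n.+1] refines stage [n] so that [r] comes within 1/(n+1) of its infimum over all
   subsequences of stage [n]. *)
pose Phi := fix Phi n := if n is m.+1 then Phi m \o s (m, Phi m) else id.
have PhiP n : increasing_seq (Phi n).
  by elim: n => //= n IH; apply: increasing_seq_comp => //; exact: (sP (_, _)).1.
pose chi n := Phi n n.
have chiP : increasing_seq chi.
  apply/increasing_seqP => n; rewrite /chi /= (leW_mono (PhiP n)).
  exact: increasing_seq_ge (sP (n, Phi n)).1.
have PhiD n k m : exists j, Phi (n + k)%N m = Phi n j.
  elim: k m => [|k IH] m; first by exists m; rewrite addn0.
  by rewrite addnS /=; exact: IH.
(* From index [n] on, the diagonal is a subsequence of stage [n]. *)
have tauP n : exists2 tau, increasing_seq tau & chi \o addn n = Phi n \o tau.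
  have /choice[tau tauE] k : exists j, chi (n + k)%N = Phi n j by exact: PhiD.
  exists tau; last exact/funext.
  by move=> i j; rewrite -[LHS](PhiP n) -!tauE chiP leq_add2l.
exists chi => // psi psiP; apply/ler_addgt0Pr => e e0.
have [n _ /(_ n (leqnn n))/= ne] := near_infty_natSinv_lt (PosNum e0).
have [tau' tau'P tau'E] := tauP n.+1.
(* r chi <= r (Phi n.+1) <= inf (J (Phi n)) + 1/(n+1), and a tail of [chi \o psi] is a subsequence
   of [Phi n], so this infimum is at most r (chi \o psi). *)
apply: le_trans (r_tail _ n.+1 chiP) _; rewrite tau'E.
apply: le_trans (r_sub _ _ (PhiP _) tau'P) _.
apply: le_trans (sP (n, Phi n)).2 _; apply: lerD; last exact: ltW.
have [tau tauiP tauE] := tauP n.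
pose psi' k := (psi (n + k) - n)%N.
have psi'E k : (n + psi' k = psi (n + k))%N.
  by rewrite subnKC// (leq_trans (leq_addr k n))// increasing_seq_ge.
have psi'P : increasing_seq psi'.
  by move=> i j; rewrite -[LHS](leq_add2l n) !psi'E -[RHS](leq_add2l n); exact: psiP.
have chipsi : (chi \o psi) \o addn n = Phi n \o (tau \o psi').
  apply/funext => k /=; rewrite -psi'E.
  by rewrite -[LHS]/((chi \o addn n) (psi' k)) tauE.
apply: (@le_trans _ _ (r ((chi \o psi) \o addn n))).
  rewrite chipsi; apply: ge_inf => //; exists (tau \o psi') => //.
  exact: increasing_seq_comp.
apply: r_sub; first exact: increasing_seq_comp.
by move=> i j; exact: leq_add2l.
Qed.

End Subsequences.

(** * Delta-convergence and Delta-compactness *)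

Section DeltaConvergence.
Context {R : realType} {X : metricType R}.
Implicit Types (y : nat -> X) (c : X) (S : set X) (phi : nat -> nat).

Lemma bounded_subseq y phi : bounded_sequence y -> bounded_sequence (y \o phi).
Proof. by move=> [a [M yM]]; exists a, M => k; exact: yM. Qed.

Lemma radius_subseq S y phi : bounded_sequence y -> S !=set0 ->
  increasing_seq phi -> asymp_radius S (y \o phi) <= asymp_radius S y.
Proof.
move=> yb S0 phiP; apply/ler_addgt0Pr => e e0.
have [q Sq qr] := radius_adherent yb S0 e0.
exact: (radius_le Sq (near_subseq phiP qr)).
Qed.

Lemma radius_shift S y n : bounded_sequence y -> S !=set0 ->
  asymp_radius S y <= asymp_radius S (y \o addn n).
Proof.
move=> yb S0; apply/ler_addgt0Pr => e e0.
have [q Sq [N _ NP]] := radius_adherent (bounded_subseq (addn n) yb) S0 e0.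
apply: (radius_le Sq); exists (n + N)%N => // k /= nNk.
have nk : (n <= k)%N by apply: leq_trans nNk; exact: leq_addr.
by have := NP (k - n)%N; rewrite /= subnKC//; apply; rewrite leq_subRL.
Qed.

Lemma Delta_cvg_center y c : @is_cat0 R X -> bounded_sequence y ->
  (forall phi, increasing_seq phi -> is_center setT (y \o phi) c) ->
  Delta_cvg y c.
Proof.
move=> X0 yb cP; split => // phi phiP.
by apply: asymptotic_center_eq (cP _ phiP) => //; exact: bounded_subseq.
Qed.

Lemma cvg_Delta_cvg y c : @is_cat0 R X -> bounded_sequence y ->
  y @ \oo --> c -> Delta_cvg y c.
Proof.
move=> X0 yb yc; apply: Delta_cvg_center => // phi phiP; split => // e e0.
have yce : \forall k \near \oo, mdist c (y k) <= e.
  exact: metricType_numDomainType.cvgr_dist_le yc _ e0.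
apply: filterS (near_subseq phiP yce) => k /= ck; apply: (le_trans ck); rewrite lerDr.
by apply: radius_ge0; [exact: bounded_subseq|exists c].
Qed.

(** On a regular subsequence, one whose radius no further extraction lowers, the center remains a
    center of every further subsequence. *)
Lemma Delta_cvg_subseq S y : is_hadamard X -> closed S -> geod_convex S ->
  (forall k, S (y k)) -> bounded_sequence y ->
  exists phi c, [/\ increasing_seq phi, S c & Delta_cvg (y \o phi) c].
Proof.
move=> XH Scl Sc Sy yb; have T0 : [set: X] !=set0 by exists (y 0%N).
have [phi phiP regular] : exists2 phi, increasing_seq phi & forall psi,
    increasing_seq psi ->
    asymp_radius setT (y \o phi) <= asymp_radius setT (y \o (phi \o psi)).
  apply: (@diagonal_subseq R (fun phi => asymp_radius setT (y \o phi))).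
  - by move=> phi; apply: radius_ge0 => //; exact: bounded_subseq.
  - by move=> phi psi _ psiP; exact: (radius_subseq (bounded_subseq phi yb) T0 psiP).
  - by move=> phi n _; exact: (radius_shift n (bounded_subseq phi yb) T0).
have zb := bounded_subseq phi yb; have Tc : geod_convex [set: X] by [].
have [c cP] := center_exists XH closedT Tc T0 zb.
exists phi, c; split => //.
  by apply: center_in XH Scl Sc _ zb cP => k; exact: Sy.
apply: Delta_cvg_center XH.2 zb _ => psi psiP; split => // e e0.
apply: filterS (near_subseq psiP (cP.2 _ e0)) => k /= /le_trans; apply.
by rewrite lerD2r; exact: regular.
Qed.

End DeltaConvergence.

(** * A real recursion with divergent weights *)

Section Recursion.
Context {R : realType}.

(** If B is the sum of the weights since a fixed index, (1 + B)(s_n - e/2) stays bounded because (1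
    + B + a)(1 - a) <= 1 + B for a, B >= 0; and B tends to infinity. *)
Lemma recursion_cvg0 (s alpha : nat -> R) : (forall k, 0 <= s k) ->
  (forall k, 0 < alpha k < 1) ->
  (\sum_(1 <= k < n) alpha k) @[n --> \oo] --> +oo ->
  (forall e, 0 < e -> \forall k \near \oo,
    s k.+1 <= (1 - alpha k) * s k + alpha k * e) ->
  s @ \oo --> (0 : R).
Proof.
move=> s0 a01 /cvgryPge asum rec; apply/cvgrPdist_le => e e0.
have [|N _ NP] := rec (e / 2); first by rewrite divr_gt0.
pose A n := \sum_(1 <= k < n) alpha k; pose C := `|s N.+1 - e / 2|.
have C0 : 0 <= C by exact: normr_ge0.
(* Starting at [N.+1] keeps [n] positive, so that the sum from index 1 does gain the term
   [alpha n]. *)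
have claim n : (N < n)%N ->
    0 <= A n - A N.+1 /\ (1 + (A n - A N.+1)) * (s n - e / 2) <= C.
  elim: n => // n IH; rewrite ltnS leq_eqVlt => /orP[/eqP <-|Nn].
    by rewrite subrr lexx addr0 mul1r ler_norm.
  have [B0 BC] := IH Nn; have AE : A n.+1 = A n + alpha n.
    by rewrite /A big_nat_recr//=; exact: leq_ltn_trans Nn.
  have sn := NP n (ltnW Nn); rewrite /= in sn; have /andP[al0 al1] := a01 n.
  rewrite AE; move: B0 BC => B0 BC.
  set B := A n - A N.+1 in B0 BC.
  have -> : A n + alpha n - A N.+1 = B + alpha n by rewrite /B; ring.
  split; first by rewrite addr_ge0// ltW.
  have B1 : 0 <= 1 + (B + alpha n) by lra.
  apply: (@le_trans _ _ ((1 + (B + alpha n)) * ((1 - alpha n) * (s n - e / 2)))).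
    by rewrite ler_wpM2l//; lra.
  have [sneg|spos] := leP (s n - e / 2) 0.
    apply: le_trans C0; apply: mulr_ge0_le0 => //; apply: mulr_ge0_le0 => //; lra.
  apply: le_trans BC; rewrite mulrA; apply: ler_wpM2r; [exact: ltW|nra].
near=> n; rewrite sub0r normrN ger0_norm//.
have Nn : (N < n)%N by near: n; exact: nbhs_infty_gt.
have [_ sC] := claim n Nn.
(* For such n, s_n > e would give (1 + 2C/e)(e/2) = e/2 + C <= C. *)
have An : A N.+1 + 2 * C / e <= A n by near: n; exact: asum.
rewrite leNgt; apply/negP => se.
have : (1 + 2 * C / e) * (e / 2) <= C.
  apply: le_trans sC; apply: ler_pM; [|lra|lra|lra].
  by rewrite addr_ge0// divr_ge0// ?mulr_ge0// ltW.
have -> : (1 + 2 * C / e) * (e / 2) = e / 2 + C by field; rewrite lt0r_neq0.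
lra.
Unshelve. all: by end_near. Qed.

End Recursion.

(** * The equilibrium set is closed and convex *)

Section Equilibrium.
Context {R : realType} {X : metricType R} (X0 : @is_cat0 R X).
Context (K : set X) (K_closed : closed K) (K_convex : geod_convex K).
Context (f : X -> X -> R).
Hypothesis f_usc :
  forall y, K y -> Delta_upper_semicontinuous_on K (fun x => f x y).

Lemma Delta_usc_ge0 (g : X -> R) (y : nat -> X) p :
  Delta_upper_semicontinuous_on K g -> (forall n, K (y n)) -> K p ->
  Delta_cvg y p -> (forall e, 0 < e -> \forall n \near \oo, - e <= g (y n)) ->
  0 <= g p.
Proof.
move=> gusc Ky Kp yp gy; rewrite leNgt; apply/negP => gp.
(* If g p < 0, some n has g p / 2 <= g (y n) <= 3 g p / 4, which is absurd. *)
have e1 : 0 < - g p / 4 by lra.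
have e2 : 0 < - g p / 2 by lra.
have g1 := (limn_esup_leP _ _).1 (gusc _ _ Ky Kp yp) _ e1.
have [n [/= h1 h2]] := filter_ex (filterI g1 (gy _ e2)).
lra.
Qed.

(** Metric limits are Delta-limits, so Delta-upper semicontinuity applies to a sequence of
    equilibrium points. *)
Lemma equilibrium_points_closed : closed (equilibrium_points K f).
Proof.
apply/closed_metricP => x xS.
have Kx : K x.
  apply: ((closed_metricP K).2 K_closed) => e /xS[y [Ky _] xy].
  by exists y.
have /choice[y yP] n : exists y, equilibrium_points K f y /\
    mdist x y < n.+1%:R^-1.
  have n0 : 0 < n.+1%:R^-1 :> R by rewrite invr_gt0.
  by have [y Sy xy] := xS _ n0; exists y.
have yx : y @ \oo --> x.
  apply/metricType_numDomainType.cvgrPdist_lt => e e0.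
  apply: filterS (near_infty_natSinv_lt (PosNum e0)) => n /=.
  exact/lt_trans/(yP n).2.
have yb : bounded_sequence y.
  exists x, 1 => n; apply: le_trans (ltW (yP n).2) _.
  by rewrite invf_le1// ler1n.
split=> // w Kw; apply: Delta_usc_ge0 (f_usc Kw) _ Kx (cvg_Delta_cvg X0 yb yx) _.
  by move=> n; have [[]] := yP n.
move=> e e0; apply: nearW => n; have [[_ /(_ _ Kw) fy] _] := yP n.
by apply: le_trans fy; rewrite oppr_le0 ltW.
Qed.

Hypothesis f_pseudo : pseudo_monotone K f.
Hypothesis f_diag : forall x, K x -> f x x = 0.
Hypothesis f_convex : forall x, K x -> geod_convex_fun K (f x).

(* Minty's trick: 0 = f z z <= (1 - t) f z x + t f z y with f z x <= 0 gives
   0 <= f z y at the points z of [x, y]; then let z tend to x. *)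
Lemma equilibrium_points_minty :
  equilibrium_points K f = [set x | K x /\ forall y, K y -> f y x <= 0].
Proof.
apply/seteqP; split=> x /= [Kx Hx]; split => // y Ky.
  by apply: f_pseudo => //; exact: Hx.
pose t n : R := n.+1%:R^-1.
have t_gt0 n : 0 < t n by rewrite invr_gt0.
have t_le1 n : t n <= 1 by rewrite invf_le1// ler1n.
have t01 n : 0 <= t n <= 1 by rewrite t_le1 ltW.
have /choice[z zP] n := geod_comb_exists x y X0 (t01 n).
have Kz n : K (z n) by have [+ _ _] := zP n; exact: K_convex.
have xz n : mdist x (z n) = t n * mdist x y by have [] := zP n.
have zx : z @ \oo --> x.
  apply/metricType_numDomainType.cvgrPdist_lt => e e0.
  have d0 : 0 < mdist x y + 1 by rewrite ltr_wpDl ?mdist_ge0.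
  have e1 : 0 < e / (mdist x y + 1) by rewrite divr_gt0.
  apply: filterS (near_infty_natSinv_lt (PosNum e1)) => n /=.
  rewrite ltr_pdivlMr// -/(t n) => tn; rewrite xz; apply: le_lt_trans tn.
  by apply: ler_wpM2l; [exact: ltW|lra].
have zb : bounded_sequence z.
  by exists x, (mdist x y) => n; rewrite xz ler_piMl ?mdist_ge0.
apply: (Delta_usc_ge0 (f_usc Ky) Kz Kx (cvg_Delta_cvg X0 zb zx)) => e e0.
apply: nearW => n; apply: (@le_trans _ _ 0); first by rewrite oppr_le0 ltW.
have := f_convex (Kz n) Kx Ky (t01 n) (zP n); rewrite f_diag// => fz.
have h : (1 - t n) * f (z n) x <= 0.
  by apply: mulr_ge0_le0; [rewrite subr_ge0|exact: Hx].
by rewrite -(pmulr_rge0 _ (t_gt0 n)); lra.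
Qed.

(** Minty's form describes the set by sublevel conditions on the convex functions [f w]. *)
Lemma equilibrium_points_convex : geod_convex (equilibrium_points K f).
Proof.
rewrite equilibrium_points_minty => x y [Kx fx] [Ky fy] z xyz.
split; first exact: K_convex xyz.
move=> w Kw; have [t /andP[t0 t1] zt] := geod_segment_comb xyz.
apply: le_trans (f_convex Kw Kx Ky _ zt) _; first by rewrite t0.
have h1 : (1 - t) * f w x <= 0.
  by apply: mulr_ge0_le0; [rewrite subr_ge0|exact: fx].
have h2 : t * f w y <= 0 by apply: mulr_ge0_le0 => //; exact: fy.
lra.
Qed.

End Equilibrium.

(** * Estimates for the resolvent *)

Section Resolvent.
Context {R : realType} {X : metricType R}.
Implicit Types (K : set X) (f : X -> X -> R) (x y z p : X).

(** Cauchy-Schwarz for two vectors sharing [z]; in this case it is the squared triangle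
    inequality. *)
Lemma quasi_lin_le x z y : quasi_lin x z z y <= mdist x z * mdist z y.
Proof.
rewrite /quasi_lin mdistxx; have := metric_triangle x z y.
have := mdist_ge0 x y; have := mdist_ge0 x z; have := mdist_ge0 z y.
nra.
Qed.

(** Pseudo-monotonicity gives f z p <= 0, so the resolvent inequality forces [quasi_lin x z z p] to
    be nonnegative. *)
Lemma resolvent_fejer K f (lambda : R) x z p : pseudo_monotone K f ->
  0 < lambda -> is_resolvent K f lambda x z -> equilibrium_points K f p ->
  mdist z p ^+ 2 <= mdist x p ^+ 2 - mdist x z ^+ 2.
Proof.
move=> fps l0 [Kz zP] [Kp pP]; have fzp := fps _ _ Kp Kz (pP _ Kz).
have := zP _ Kp; have [q0|q0] := ltP (quasi_lin x z z p) 0.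
  by have := nmulr_llt0 lambda q0; rewrite l0; lra.
by move: q0; rewrite /quasi_lin mdistxx; lra.
Qed.

(** The resolvent inequality and [quasi_lin_le] give f (z n) y >= - lambda_bar M d(x_n, z_n), with M
    an eventual bound of d(z_n, y); the right side tends to 0. *)
Lemma equilibrium_of_Delta_limit K f (lambda : nat -> R) (lambda_bar : R)
    (x z : nat -> X) q :
  (forall y, K y -> Delta_upper_semicontinuous_on K (fun x => f x y)) ->
  (forall n, 0 <= lambda n <= lambda_bar) ->
  (forall n, is_resolvent K f (lambda n) (x n) (z n)) ->
  (fun n => mdist (x n) (z n)) @ \oo --> (0 : R) ->
  Delta_cvg z q -> K q -> equilibrium_points K f q.
Proof.
move=> f_usc l_itv zP xz zq Kq; split => // y Ky.
have Kz n : K (z n) by have [] := zP n.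
apply: (Delta_usc_ge0 (f_usc _ Ky) Kz Kq zq) => e e0.
have [M zM] := bounded_sequence_near y zq.1.
have M0 := near_mdist_ge0 zM.
have lb0 : 0 <= lambda_bar by have /andP[] := l_itv 0%N; exact: le_trans.
have c0 : 0 < lambda_bar * M + 1 by rewrite ltr_wpDl ?mulr_ge0.
have e1 : 0 < e / (lambda_bar * M + 1) by rewrite divr_gt0.
have /cvgrPdist_le/(_ _ e1) xze := xz.
near=> n.
have zy : mdist (z n) y <= M by rewrite metric_sym; near: n.
have : mdist (x n) (z n) <= e / (lambda_bar * M + 1).
  rewrite -(ger0_norm (mdist_ge0 _ _)) -normrN -sub0r; near: n; exact: xze.
rewrite ler_pdivlMr// => xzn; have /andP[ln0 lnb] := l_itv n.
have := (zP n).2 _ Ky; have q1 := quasi_lin_le (x n) (z n) y.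
have a0 := mdist_ge0 (x n) (z n); have b0 := mdist_ge0 (z n) y.
have : lambda n * quasi_lin (x n) (z n) (z n) y <= lambda_bar * (mdist (x n) (z n) * M).
  apply: le_trans (ler_wpM2l ln0 q1) _.
  apply: ler_pM => //; first by rewrite mulr_ge0.
  exact: ler_wpM2l.
lra.
Unshelve. all: by end_near. Qed.

End Resolvent.

(** * Asymptotic control of the anchor term *)

Section Halpern.
Context {R : realType} {X : metricType R} (XH : is_hadamard X).
Context (K : set X) (K_closed : closed K) (K_convex : geod_convex K).
Context (f : X -> X -> R).
Hypothesis f_usc :
  forall y, K y -> Delta_upper_semicontinuous_on K (fun x => f x y).
Context (lambda : nat -> R) (lambda_bar : R).
Hypothesis lambda_itv : forall k, 0 <= lambda k <= lambda_bar.
Context (alpha : nat -> R).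
Hypothesis alpha_itv : forall k, 0 < alpha k < 1.
Hypothesis alpha_cvg0 : alpha @ \oo --> (0 : R).
Context (x z : nat -> X).
Hypothesis zP : forall k, is_resolvent K f (lambda k) (x k) (z k).

Lemma near_alpha_le (e : R) : 0 < e -> \forall k \near \oo, alpha k <= e.
Proof.
move=> e0; have /cvgrPdist_le/(_ _ e0) := alpha_cvg0; apply: filterS => k.
by rewrite sub0r normrN; apply: le_trans; exact: ler_norm.
Qed.

(* Otherwise some subsequence of z, staying in a ball around u which misses
   the projection p of u, would Delta-converge to a point of the equilibrium
   set inside that ball. *)
Lemma proj_defect_le u p (e : R) :
  is_proj (equilibrium_points K f) u p -> 0 < e ->
  exists2 d, 0 < d & \forall k \near \oo, mdist (x k) (z k) < d ->
    mdist u p ^+ 2 - (1 - alpha k) * mdist u (z k) ^+ 2 <= e.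
Proof.
move=> pP e0; apply: contrapT => no_d.
pose D := mdist u p ^+ 2; have D0 : 0 <= D by exact: sqr_ge0.
have D1 : 0 < 2 * (D + 1) by lra.
have a0 : 0 < e / (2 * (D + 1)) by rewrite divr_gt0.
have [N _ NP] := near_alpha_le a0.
(* The indices [kk n] need not increase: what follows treats [z \o kk] as a sequence in its own
   right. *)
have /choice[kk kkP] n : exists k, [/\ (N <= k)%N,
    mdist (x k) (z k) < n.+1%:R^-1 &
    e < D - (1 - alpha k) * mdist u (z k) ^+ 2].
  apply: contrapT => no_k; apply: no_d; exists n.+1%:R^-1; first by rewrite invr_gt0.
  exists N => // k /= Nk xzk; rewrite leNgt; apply/negP => De.
  by apply: no_k; exists k.
(* Since alpha <= e / (2 (D + 1)), the factor 1 - alpha costs less than e/2; the other half of e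
   keeps the ball away from [p]. *)
pose rho := D - e / 2; pose B := [set w : X | mdist u w ^+ 2 <= rho].
have Bz n : B (z (kk n)).
  have [Nk _ De] := kkP n; have := NP _ Nk; rewrite /= ler_pdivlMr// => ae.
  have /andP[al0 al1] := alpha_itv (kk n).
  rewrite /B /= leNgt; apply/negP => zr.
  have : (1 - alpha (kk n)) * rho <= (1 - alpha (kk n)) * mdist u (z (kk n)) ^+ 2.
    by apply: ler_wpM2l; [lra|exact: ltW].
  rewrite /rho; have : 0 < alpha (kk n) * e by rewrite mulr_gt0.
  nra.
have zb : bounded_sequence (z \o kk).
  exists u, (rho + 1) => n; have := Bz n; rewrite /B /=.
  by have := mdist_ge0 u (z (kk n)); nra.
have KBz n : (K `&` B) ((z \o kk) n) by split; [have [] := zP (kk n)|exact: Bz].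
have [phi [q [phiP [Kq Bq] zq]]] := Delta_cvg_subseq XH
  (closedI K_closed (@closed_sqball _ _ u rho))
  (convexI K_convex (@convex_sqball _ _ u rho XH.2)) KBz zb.
have Sq : equilibrium_points K f q.
  apply: (equilibrium_of_Delta_limit (lambda := lambda \o kk \o phi)
    (lambda_bar := lambda_bar) (x := x \o kk \o phi) _ _ _ _ zq Kq) => //.
  - by move=> n; exact: lambda_itv.
  - by move=> n; exact: zP.
  apply/cvgrPdist_lt => d d0.
  have dn := near_subseq phiP (near_infty_natSinv_lt (PosNum d0)).
  apply: filterS dn => n /=; rewrite sub0r normrN ger0_norm ?mdist_ge0//.
  by apply: lt_trans; have [] := kkP (phi n).
have [[_ pmin] _] := pP; have := pmin q Sq.
rewrite -(ler_sqr (x := mdist u p)) ?nnegrE ?mdist_ge0//.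
by move: Bq; rewrite /B /= /rho -/D; lra.
Qed.

End Halpern.

(** * Strong convergence of the Halpern iteration *)

Theorem theorem3p23 (R : realType) (X : metricType R) (hX : is_hadamard X)
  (K : set X) (K_closed : closed K) (K_convex : geod_convex K)
  (theta : R) (theta_ge0 : 0 <= theta) (f : X -> X -> R)
  (f_pseudo : pseudo_monotone K f) (f_under : under_monotone K theta f)
  (f_diag : forall x, K x -> f x x = 0)
  (f_lsc : forall x, K x -> lower_semicontinuous_on K (f x))
  (f_convex : forall x, K x -> geod_convex_fun K (f x))
  (S_neq0 : equilibrium_points K f !=set0)
  (f_usc : forall y, K y -> Delta_upper_semicontinuous_on K (fun x => f x y))
  (lambda : nat -> R) (lambda_bar : R) (lambda_bar_gt : theta < lambda_bar)
  (lambda_itv : forall k, theta < lambda k <= lambda_bar)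
  (u x0 : X) (alpha : nat -> R) (alpha_itv : forall k, 0 < alpha k < 1)
  (alpha_cvg0 : alpha @ \oo --> (0 : R))
  (alpha_sum : (\sum_(1 <= k < n) alpha k) @[n --> \oo] --> +oo)
  (x Jx : nat -> X) (x_init : x 0%N = x0)
  (Jx_resolvent : forall k, is_resolvent K f (lambda k) (x k) (Jx k))
  (x_step : forall k, is_geod_comb (1 - alpha k) u (Jx k) (x k.+1)) :
  exists2 p : X, is_proj (equilibrium_points K f) u p & x @ \oo --> p.
Proof.
have X0 := hX.2.
have [p pP] := proj_exists u hX (equilibrium_points_closed X0 K_closed f_usc)
  (equilibrium_points_convex X0 K_convex f_usc f_pseudo f_diag f_convex) S_neq0.
exists p => //; have [[Sp _] _] := pP.
have l_gt0 k : 0 < lambda k.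
  by have /andP[+ _] := lambda_itv k; exact: le_lt_trans.
have l_itv k : 0 <= lambda k <= lambda_bar.
  by rewrite ltW//=; have /andP[] := lambda_itv k.
pose s k := mdist (x k) p ^+ 2; pose g k := mdist (x k) (Jx k) ^+ 2.
pose D := mdist u p ^+ 2; have D0 : 0 <= D by exact: sqr_ge0.
have sS k : s k.+1 <= (1 - alpha k) * s k - (1 - alpha k) * g k
                      + alpha k * (D - (1 - alpha k) * mdist u (Jx k) ^+ 2).
  have /andP[a0 a1] := alpha_itv k.
  have a01 : 0 <= 1 - alpha k <= 1 by apply/andP; split; lra.
  (* The ratio from [u] is 1 - alpha, so [u] has weight alpha; the negative term of CN supplies the
     one with d(u, Jx_k)^2. *)
  have := cn_ineq p X0 a01 (x_step k).
  have fejer := resolvent_fejer f_pseudo (l_gt0 k) (Jx_resolvent k) Sp.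
  have : (1 - alpha k) * mdist (Jx k) p ^+ 2 <= (1 - alpha k) * (s k - g k).
    by apply: ler_wpM2l; [lra|exact: fejer].
  by rewrite -/(s k.+1) -/D; lra.
suff s0 : s @ \oo --> (0 : R).
  apply/metricType_numDomainType.cvgrPdist_lt => e e0.
  have e2 : 0 < e ^+ 2 by rewrite exprn_gt0.
  have /cvgrPdist_lt/(_ _ e2) := s0; apply: filterS => k.
  rewrite sub0r normrN ger0_norm ?sqr_ge0// metric_sym.
  by rewrite ltr_sqr ?nnegrE ?mdist_ge0// ltW.
apply: (recursion_cvg0 _ alpha_itv alpha_sum) => [k|e e0]; first exact: sqr_ge0.
have [d d0 dP] := proj_defect_le hX K_closed K_convex f_usc l_itv alpha_itv
  alpha_cvg0 Jx_resolvent pP e0.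
have d2 : 0 < d ^+ 2 by rewrite exprn_gt0.
have Dd : 0 < D + d ^+ 2 by rewrite ltr_wpDl.
(* Below this threshold alpha D <= (1 - alpha) d^2, so a gap g_k >= d^2 absorbs the anchor term. *)
have ad : 0 < d ^+ 2 / (D + d ^+ 2) by rewrite divr_gt0.
near=> k; apply: le_trans (sS k) _; have /andP[a0 a1] := alpha_itv k.
have [xJ|xJ] := ltP (mdist (x k) (Jx k)) d.
  have t_le : D - (1 - alpha k) * mdist u (Jx k) ^+ 2 <= e.
    by move: xJ; near: k.
  have := ler_wpM2l (ltW a0) t_le.
  have : 0 <= (1 - alpha k) * g k by rewrite mulr_ge0 ?sqr_ge0// subr_ge0 ltW.
  lra.
have ak : alpha k * (D + d ^+ 2) <= d ^+ 2.
  rewrite -ler_pdivlMr//; near: k; exact: near_alpha_le alpha_cvg0 _ ad.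
have gk : d ^+ 2 <= g k by rewrite ler_sqr ?nnegrE ?mdist_ge0// ltW.
have h1 : (1 - alpha k) * d ^+ 2 <= (1 - alpha k) * g k.
  by apply: ler_wpM2l => //; rewrite subr_ge0 ltW.
have h2 : 0 <= alpha k * ((1 - alpha k) * mdist u (Jx k) ^+ 2).
  apply: mulr_ge0 (ltW a0) _; apply: mulr_ge0; last exact: sqr_ge0.
  by rewrite subr_ge0 ltW.
have h3 : 0 < alpha k * e by rewrite mulr_gt0.
lra.
Unshelve. all: by end_near. Qed.
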